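(* Let $\mathcal{G}=(\mathcal{V},\mathcal{E})$ be a connected undirected graph with vertex set $\mathcal{V}=\{1,\ldots,n\}$. Let $\mathcal{C}$ be the feasible set of the fastest mixing Markov chain (FMMC) problem on $\mathcal{G}$, and let $\mathcal{F}=\{P\in\mathcal{C} : \sigma(P)=P \text{ for all } \sigma\in\mathrm{Aut}(\mathcal{G})\}$ be the fixed-point subset of $\mathcal{C}$ under $\mathrm{Aut}(\mathcal{G})$. Then the FMMC problem always has an optimal solution in $\mathcal{F}$; that is, there exists $P\in\mathcal{F}$ with $\mu(P)=\inf\{\mu(P') : P'\in\mathcal{C}\}$.
   Context: The graph is finite and simple. The feasible set is $$\mathcal{C}=\{P\in\mathbb{R}^{n\times n} : P\ge 0 \text{ (elementwise)},\ P\mathbf{1}=\mathbf{1},\ P=P^T,\ P_{ij}=0 \text{ for } i\neq j,\ \{i,j\}\notin\mathcal{E}\},$$ where $\mathbf{1}$ is the all-ones vector (diagonal entries $P_{ii}$ are allowed to be nonzero). For $P\in\mathcal{C}$ with eigenvalues $1=\lambda_1(P)\ge\lambda_2(P)\ge\cdots\ge\lambda_n(P)\ge -1$ (with multiplicity), the second-largest eigenvalue modulus is $\mu(P)=\max_{i=2,\ldots,n}|\lambda_i(P)|=\max\{\lambda_2(P),-\lambda_n(P)\}$; equivalently $\mu(P)=\|P-(1/n)\mathbf{1}\mathbf{1}^T\|_2$ (spectral norm). The FMMC problem is to minimize $\mu(P)$ over $P\in\mathcal{C}$. $\mathrm{Aut}(\mathcal{G})$ is the group of permutations $\sigma$ of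 $\mathcal{V}$ such that $\{i,j\}\in\mathcal{E}$ if and only if $\{\sigma(i),\sigma(j)\}\in\mathcal{E}$. It acts on matrices by $\sigma(P)=QPQ^T$, where $Q$ is the permutation matrix with $Q_{ij}=1$ if $i=\sigma(j)$ and $Q_{ij}=0$ otherwise. *)

(* Defs.v *)
From mathcomp Require Import all_boot all_order all_algebra all_fingroup.
From mathcomp Require Import spectral sesquilinear complex polyrcf.
From mathcomp Require Import boolp classical_sets reals.

Set Implicit Arguments.
Unset Strict Implicit.
Unset Printing Implicit Defensive.

Import Order.TTheory GRing.Theory Num.Theory.

Local Open Scope classical_set_scope.
Local Open Scope ring_scope.

(* A simple graph on {0, .., n-1} is a symmetric irreflexive e : rel 'I_n. *)

Definition connected_graph n (e : rel 'I_n) : Prop :=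
  forall i j : 'I_n, connect e i j.

Definition graph_aut n (e : rel 'I_n) : {set {perm 'I_n}} :=
  [set s : {perm 'I_n} | [forall i, forall j, e (s i) (s j) == e i j]]%SET.

(* This is the transpose of the library's perm_mx s, whose (i, j) entry is
   (s i == j)%:R. *)
Definition permQ (R : realType) n (s : {perm 'I_n}) : 'M[R]_n :=
  \matrix_(i, j) (i == s j)%:R.

Definition perm_act (R : realType) n (s : {perm 'I_n}) (P : 'M[R]_n) : 'M[R]_n :=
  permQ R s *m P *m (permQ R s)^T.

Definition feasible (R : realType) n (e : rel 'I_n) : set 'M[R]_n :=
  [set P : 'M[R]_n |
    [/\ forall i j, 0 <= P i j,
        P *m const_mx 1 = const_mx 1 :> 'cV[R]_n,
        P = P^T
      & forall i j, i != j -> ~~ e i j -> P i j = 0]].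

Definition fixed_feasible (R : realType) n (e : rel 'I_n) : set 'M[R]_n :=
  [set P : 'M[R]_n |
    feasible e P /\ forall s : {perm 'I_n}, s \in graph_aut e -> perm_act s P = P].

(* The real eigenvalues of P in non-increasing order, each repeated according
   to its multiplicity as a root of the characteristic polynomial; by
   char_poly_eigvals below these are all n eigenvalues when P is symmetric. *)
Definition eigvals (R : realType) n (P : 'M[R]_n) : seq R :=
  sort >=%R (flatten [seq nseq (mup x (char_poly P)) x
                     | x <- rootsR (char_poly P)]).

(* Indices start at 0, so the range 1 <= i < n skips the largest eigenvalue;
   for n = 1 the range is empty and the value is 0. *)
Definition slem (R : realType) n (P : 'M[R]_n) : R :=
  \big[Num.max/0]_(1 <= i < n) `|(eigvals P)`_i|.

Lemma eigvals_sorted (R : realType) n (P : 'M[R]_n) : sorted >=%R (eigvals P).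
Proof. by apply: sort_sorted => x y; exact: le_total. Qed.

Lemma count_mem_eigvals (R : realType) n (P : 'M[R]_n) (x : R) :
  count_mem x (eigvals P) = mup x (char_poly P).
Proof.
have p0 : char_poly P != 0 by rewrite monic_neq0 ?char_poly_monic.
have rP y : (y \in rootsR (char_poly P)) = root (char_poly P) y.
  by rewrite (roots_onP (roots_on_rootsR p0)).
have : uniq (rootsR (char_poly P)) by exact: uniq_roots.
rewrite /eigvals count_sort count_flatten -map_comp.
move: rP; set r := rootsR _ => rP r_uniq.
have -> : [seq (count_mem x \o (fun y => nseq (mup y (char_poly P)) y)) y | y <- r]
    = [seq ((y == x) * mup x (char_poly P))%N | y <- r].
  by apply: eq_map => y /=; rewrite count_nseq /=; case: eqVneq => [->|].
have -> s : sumn [seq ((y == x) * mup x (char_poly P))%N | y <- s]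
    = (count_mem x s * mup x (char_poly P))%N.
  by elim: s => //= y s ->; rewrite mulnDl.
rewrite count_uniq_mem // rP; case: rootP => [_|/rootP px]; first by rewrite mul1n.
by rewrite mupNroot.
Qed.

Lemma char_poly_eigvals (R : realType) n (P : 'M[R]_n) : P = P^T ->
  char_poly P = \prod_(x <- eigvals P) ('X - x%:P).
Proof.
move=> Psym.
suff [s ps] : exists s : seq R, char_poly P = \prod_(x <- s) ('X - x%:P).
  rewrite {1}ps; apply/perm_big/allP => x _ /=.
  by rewrite count_mem_eigvals ps mu_prod_XsubC.
pose f := real_complex R; pose A := map_mx f P.
have Ah : A \is hermsymmx.
  apply: realsym_hermsym; last by apply/mxOverP => i j; rewrite mxE complex_real.
  by apply/is_hermitianmxP; rewrite expr0 scale1r map_mx_id // /A map_trmx -Psym.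
have /orthomx_spectralP AE := hermitian_normalmx Ah.
have /mxOverP dreal := hermitian_spectral_diag_real Ah.
set d := spectral_diag A in AE dreal; set Q := spectralmx A in AE.
have Qu : Q \in unitmx := unitarymx_unit (spectral_unitarymx A).
have cA : char_poly A = char_poly (diag_mx d).
  pose q := map_mx polyC Q; have qu : q \in unitmx.
    by rewrite unitmxE det_map_mx rmorph_unit // -unitmxE.
  have -> : char_poly A = \det (invmx q *m char_poly_mx (diag_mx d) *m q).
    congr (\det _); rewrite /char_poly_mx mulmxBr mulmxBl.
    rewrite scalar_mxC -!mulmxA mulVmx // mulmx1.
    by rewrite {1}AE !map_mxM /= map_invmx -mulmxA.
  by rewrite !det_mulmx mulrAC -det_mulmx mulVmx // det1 mul1r.
exists [seq complex.Re (d 0 i) | i <- enum 'I_n].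
apply: (map_poly_inj f); rewrite map_char_poly -/A cA char_poly_trig.
  rewrite rmorph_prod big_map big_enum /=; apply: eq_bigr => i _.
  rewrite mxE eqxx mulr1n rmorphB /= map_polyX map_polyC /=.
  by rewrite /f RRe_real.
exact: diag_mx_is_trig.
Qed.

(* Main.v *)
(* For feasible P the spectrum of M = P - J/n, J the all-ones matrix, is that of
   P with one eigenvalue 1 replaced by 0, so slem P <= c exactly when
   |v M v^T| <= c v v^T for every row vector v.  This condition is closed
   in (P, c), convex in P, and invariant under simultaneous permutation of rows
   and columns: by compactness slem attains its minimum on the feasible set, and
   averaging a minimizer over the automorphism group gives a fixed minimizer. *)
Require Import Defs.
From mathcomp Require Import all_boot all_order all_algebra all_fingroup.
From mathcomp Require Import spectral sesquilinear complex ring lra.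
From mathcomp Require Import boolp classical_sets reals.
From mathcomp Require Import topology normedtype derive.

Set Implicit Arguments.
Unset Strict Implicit.
Unset Printing Implicit Defensive.

Import Order.TTheory GRing.Theory Num.Theory.
Import numFieldNormedType.Exports.
Local Open Scope classical_set_scope.
Local Open Scope sesquilinear_scope.
Local Open Scope ring_scope.

(** * Quadratic forms and eigenvalues *)

Definition quad (R : pzRingType) n (S : 'M[R]_n) (v : 'rV[R]_n) : R :=
  (v *m S *m v^T) 0 0.

Lemma quadE (R : comPzRingType) n (S : 'M[R]_n) (v : 'rV[R]_n) :
  quad S v = \sum_i \sum_j v 0 i * v 0 j * S i j.
Proof.
rewrite /quad mxE exchange_big; apply: eq_bigr => i _.
rewrite !mxE mulr_suml; apply: eq_bigr => j _.
by rewrite -mulrA mulrCA mulrC.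
Qed.

Lemma quad1E (R : comPzRingType) n (v : 'rV[R]_n) :
  quad 1%:M v = \sum_i v 0 i ^+ 2.
Proof. by rewrite /quad mulmx1 mxE; apply: eq_bigr => i _; rewrite mxE. Qed.

Lemma quad1_gt0 (R : realDomainType) n (v : 'rV[R]_n) : v != 0 ->
  0 < quad 1%:M v.
Proof.
move=> /rV0Pn[i vi]; rewrite quad1E (bigD1 i) //= ltr_wpDr //.
  by rewrite sumr_ge0 // => j _; rewrite sqr_ge0.
by rewrite exprn_even_gt0.
Qed.

(** At an eigenvector [v] for [x] the form equals [x * quad 1%:M v], and the positive factor
    [quad 1%:M v] cancels. *)
Lemma root_char_poly_quad (R : realFieldType) n (S : 'M[R]_n) (c x : R) :
  (forall v, `|quad S v| <= c * quad 1%:M v) ->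
  root (char_poly S) x -> `|x| <= c.
Proof.
move=> qS; rewrite -eigenvalue_root_char => /eigenvalueP[v vS v0].
have := qS v; have := quad1_gt0 v0.
rewrite {2}/quad vS -[v in x *: v]mulmx1 -scalemxAl mxE -/(quad _ _) => v_gt0.
by rewrite normrM (gtr0_norm v_gt0) ler_pM2r.
Qed.

(* In a unitary eigenbasis of S over R[i] the two sides become
   |\sum_i r_i |u_i|^2| and c * \sum_i |u_i|^2, with r_i the eigenvalues. *)
Lemma quad_root_char_poly (R : realType) n (S : 'M[R]_n) (c : R) : S = S^T ->
  (forall x, root (char_poly S) x -> `|x| <= c) ->
  forall v, `|quad S v| <= c * quad 1%:M v.
Proof.
move=> Ssym rootS v.
pose f := real_complex R; pose A := map_mx f S; pose w := map_mx f v.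
have Ah : A \is hermsymmx.
  apply: realsym_hermsym; last by apply/mxOverP => i j; rewrite mxE complex_real.
  by apply/is_hermitianmxP; rewrite expr0 scale1r map_mx_id // /A map_trmx -Ssym.
have /orthomx_spectralP AE := hermitian_normalmx Ah.
have /mxOverP dreal := hermitian_spectral_diag_real Ah.
have Qun := spectral_unitarymx A.
set d := spectral_diag A in AE dreal; set Q := spectralmx A in AE Qun.
pose r i := complex.Re (d 0 i).
have dE i : d 0 i = f (r i) by rewrite /f RRe_real.
(* Row [i] of [Q] is an eigenvector of [A] for [r i]; it is nonzero because [Q] is unitary. *)
have rle i : `|r i| <= c.
  apply: rootS; rewrite -(fmorph_root f) map_char_poly -eigenvalue_root_char.
  apply/eigenvalueP; exists (row i Q); rewrite -/f -/A.
    rewrite {1}AE !mulmxA -row_mul mulmxV ?unitarymx_unit // row1.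
    by rewrite -rowE row_diag_mx -scalemxAl -rowE dE.
  apply/eqP => Qi0; have := congr1 (fun B => row i B) (unitarymxP Qun).
  by rewrite row_mul Qi0 mul0mx => /rowP/(_ i)/eqP; rewrite !mxE eqxx eq_sym oner_eq0.
pose u := w *m Q^t*.
have wT : w^T = w^t* by apply/matrixP => i j; rewrite !mxE conj_Creal ?complex_real.
have uT : Q *m w^T = u^t* by rewrite [in LHS]wT /u trmx_mul map_mxM trmxCK.
have qA : f (quad S v) = \sum_i f (r i) * `|u 0 i| ^+ 2.
  rewrite /quad; have -> : f ((v *m S *m v^T) 0 0) = (w *m A *m w^T) 0 0.
    by rewrite /w /A map_trmx -!map_mxM [RHS]mxE.
  rewrite {1}AE invmx_unitary // !mulmxA -/u -mulmxA uT mxE.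
  apply: eq_bigr => i _; rewrite mul_mx_diag !mxE dE normCK; ring.
have q1 : f (quad 1%:M v) = \sum_i `|u 0 i| ^+ 2.
  rewrite /quad mulmx1; have -> : f ((v *m v^T) 0 0) = (w *m w^T) 0 0.
    by rewrite /w map_trmx -!map_mxM [RHS]mxE.
  rewrite -{1}[w](mulmxKtV (m2 := n) _ Qun) //.
  rewrite -/u -mulmxA uT mxE; apply: eq_bigr => i _.
  by rewrite !mxE normCK.
have fle (a b : R) : (f a <= f b) = (a <= b) by rewrite lecR.
have fn (a : R) : f `|a| = `|f a| by rewrite normc_def /= expr0n addr0 sqrtr_sqr.
have fM (a b : R) : f (a * b) = f a * f b by rewrite /f rmorphM.
rewrite -fle fn qA fM q1 mulr_sumr (le_trans (ler_norm_sum _ _ _)) //.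
apply: ler_sum => i _; rewrite normrM -fn normrX normr_id.
by rewrite ler_wpM2r ?exprn_ge0 // fle.
Qed.

(* The determinant of the block matrix [[a, -u], [v, 1]] is computed by clearing
   either off-diagonal block; the extra factor a avoids dividing by a. *)
Lemma det_scalar_add_rank1 (R : comNzRingType) n (a : R)
    (u : 'cV[R]_n) (v : 'rV[R]_n) :
  a * \det (a%:M + u *m v) = a ^+ n * (a + (v *m u) 0 0).
Proof.
pose B := block_mx a%:M (- u) v (1%:M : 'M_1).
have detB : \det B = \det (a%:M + u *m v).
  have -> : \det B = \det (B *m block_mx 1%:M 0 (- v) 1%:M).
    by rewrite det_mulmx det_lblock !det1 !mulr1.
  rewrite mulmx_block !mulmx1 !mulmx0 mul1mx !add0r mulmxN mulNmx opprK subrr.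
  by rewrite det_ublock det1 mulr1.
have : \det (B *m block_mx 1%:M u 0 a%:M) = a ^+ n * (a + (v *m u) 0 0).
  rewrite mulmx_block !mulmx1 !mulmx0 !mul1mx !addr0.
  rewrite mul_mx_scalar mul_scalar_mx scalerN subrr det_lblock.
  by rewrite det_scalar [X in _ * X]det_mx11 !mxE eqxx mulr1n [in RHS]addrC.
by rewrite det_mulmx det_ublock det1 mul1r det_scalar expr1 detB mulrC.
Qed.

Definition deviation (R : unitRingType) n (P : 'M[R]_n) : 'M[R]_n :=
  P - const_mx n%:R^-1.

Lemma deviationE (R : unitRingType) n (P : 'M[R]_n) i j :
  deviation P i j = P i j - n%:R^-1.
Proof. by rewrite !mxE. Qed.

(* With J the matrix with entries 1/n and P J = J, one has
   (X - 1) (X I - P + J) = (X I - P) ((X - 1) I + J); take determinants. *)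
Lemma char_poly_deviation (R : numFieldType) n (P : 'M[R]_n) : (0 < n)%N ->
  P *m const_mx 1 = const_mx 1 :> 'cV_n ->
  char_poly P * 'X = ('X - 1) * char_poly (deviation P).
Proof.
move=> n_gt0 P1; pose t : {poly R} := 'X - 1.
pose u : 'cV[{poly R}]_n := const_mx 1.
pose w : 'rV[{poly R}]_n := const_mx (n%:R^-1)%:P.
have n0 : n%:R != 0 :> R by rewrite pnatr_eq0 -lt0n.
have t0 : t != 0 by rewrite monic_neq0 // monicXsubC.
have wu : (w *m u) 0 0 = 1.
  rewrite mxE (eq_bigr (fun=> (n%:R^-1)%:P)) => [|i _]; last by rewrite !mxE mulr1.
  by rewrite sumr_const card_ord -raddfMn /= -[_ *+ n]mulr_natr mulVf.
have Pu : char_poly_mx P *m u = t *: u.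
  have -> : u = map_mx polyC (const_mx 1) by rewrite map_const_mx.
  rewrite mulmxBl -map_mxM P1 mul_scalar_mx scalerBl scale1r //.
have MP : t%:M *m char_poly_mx (deviation P) =
    char_poly_mx P *m (t%:M + u *m w).
  rewrite [RHS]mulmxDr mulmxA Pu -scalemxAl mul_scalar_mx mul_mx_scalar -scalerDr.
  congr (_ *: _); rewrite /char_poly_mx /deviation map_mxB opprB addrA.
  rewrite addrAC; congr (_ + _); apply/matrixP => i j.
  by rewrite !mxE big_ord1 !mxE mul1r.
have := congr1 determinant MP; rewrite !det_mulmx det_scalar => detE.
(* Since [w *m u] is 1, the rank-one formula with [a = t] reads
   [t * \det (t%:M + u *m w) = t ^+ n * 'X]; the common factor [t ^+ n] cancels. *)
apply: (mulfI (expf_neq0 n t0)).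
have := det_scalar_add_rank1 t u w; rewrite wu subrK => rk1.
by rewrite mulrCA -rk1 mulrCA -detE mulrCA.
Qed.

(** * The second largest eigenvalue modulus as a quadratic form bound *)

Lemma feasible_row_sum (R : realType) n (e : rel 'I_n) (P : 'M[R]_n) i :
  feasible e P -> \sum_j P i j = 1.
Proof.
case=> _ /colP/(_ i) + _ _; rewrite !mxE => <-.
by apply: eq_bigr => j _; rewrite mxE mulr1.
Qed.

(** Bound [|v_i v_j|] by [(v_i^2 + v_j^2) / 2] and sum with weights [P i j], whose row and column
    sums are 1. Hence all eigenvalues of a feasible matrix lie in [[-1, 1]]. *)
Lemma feasible_quad_le (R : realType) n (e : rel 'I_n) (P : 'M[R]_n) v :
  feasible e P -> `|quad P v| <= 1 * quad 1%:M v.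
Proof.
move=> Pf; have [P0 _ Psym _] := Pf; have Pij i j : P i j = P j i by rewrite {1}Psym mxE.
have -> : 1 * quad 1%:M v =
    \sum_i \sum_j (v 0 i ^+ 2 + v 0 j ^+ 2) / 2 * P i j.
  under eq_bigr do under eq_bigr do rewrite mulrDl mulrDl.
  under eq_bigr do rewrite big_split /=.
  rewrite big_split /= [X in _ + X]exchange_big /= -big_split /= mul1r quad1E.
  apply: eq_bigr => i _; rewrite -mulr_sumr.
  under [X in _ + X]eq_bigr do rewrite Pij.
  by rewrite -mulr_sumr (feasible_row_sum i Pf) mulr1 -splitr.
rewrite quadE (le_trans (ler_norm_sum _ _ _)) // ler_sum // => i _.
rewrite (le_trans (ler_norm_sum _ _ _)) // ler_sum // => j _.
rewrite normrM (ger0_norm (P0 i j)) ler_wpM2r // ler_norml.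
apply/andP; split; first by have := sqr_ge0 (v 0 i + v 0 j); nra.
by have := sqr_ge0 (v 0 i - v 0 j); nra.
Qed.

Lemma mem_eigvals (R : realType) n (P : 'M[R]_n) x :
  P = P^T -> (x \in eigvals P) = root (char_poly P) x.
Proof. by move=> /char_poly_eigvals ->; rewrite root_prod_XsubC. Qed.

Lemma size_eigvals (R : realType) n (P : 'M[R]_n) :
  P = P^T -> size (eigvals P) = n.
Proof.
move=> /char_poly_eigvals/(congr1 (fun p : {poly R} => size p)).
by rewrite size_char_poly size_prod_XsubC => -[].
Qed.

Lemma deviation_sym (R : unitRingType) n (P : 'M[R]_n) :
  P = P^T -> deviation P = (deviation P)^T.
Proof. by move=> Psym; rewrite /deviation linearB /= trmx_const -Psym. Qed.

Lemma eigvals_feasible (R : realType) n (e : rel 'I_n) (P : 'M[R]_n) :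
  (0 < n)%N -> feasible e P ->
  exists2 t, eigvals P = 1 :: t & perm_eq (0 :: t) (eigvals (deviation P)).
Proof.
move=> n_gt0 Pf; have [_ P1 Psym _] := Pf; have Msym := deviation_sym Psym.
(* By [char_poly_deviation] the two lists are root lists of the same polynomial, so all
   multiplicities agree. *)
have sM : perm_eq (0 :: eigvals P) (1 :: eigvals (deviation P)).
  apply/allP => x _ /=; have := char_poly_deviation n_gt0 P1.
  rewrite (char_poly_eigvals Psym) (char_poly_eigvals Msym) => pE.
  have {pE} : \prod_(y <- 0 :: eigvals P) ('X - y%:P) =
      \prod_(y <- 1 :: eigvals (deviation P)) ('X - y%:P).
    by rewrite !big_cons subr0 mulrC pE.
  by move/(congr1 (fun p => mup x p)); rewrite !mu_prod_XsubC => /= ->.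
have le1 x : x \in eigvals P -> x <= 1.
  rewrite mem_eigvals // => rx; rewrite (le_trans (ler_norm x)) //.
  by apply: root_char_poly_quad rx => v; apply: feasible_quad_le Pf.
have : 1 \in eigvals P.
  by have := perm_mem sM 1; rewrite !inE eqxx oner_eq0.
have := eigvals_sorted P; case: (eigvals P) sM le1 => // h t sM le1 ht h1.
(* The head of the sorted list dominates the member 1 and is itself at most 1. *)
have h_eq1 : h = 1.
  apply/eqP; rewrite eq_le le1 ?mem_head //=; move: h1; rewrite inE.
  case/orP => [/eqP <- //|]; apply/allP: 1.
  by apply: order_path_min ht => x y z /= xy yz; apply: le_trans yz xy.
exists t; first by rewrite h_eq1.
rewrite -(perm_cons 1) -(permPr sM) h_eq1.
by apply/permPl; apply: (perm_catCA [:: 1] [:: 0] t).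
Qed.

(** The eigenvalues kept by [slem] are those of [deviation P] with one zero removed, which does not
    affect a maximum of moduli. For a symmetric matrix, bounding the eigenvalues amounts to bounding
    the form. *)
Lemma slem_leP (R : realType) n (e : rel 'I_n) (P : 'M[R]_n) (c : R) :
  (0 < n)%N -> feasible e P ->
  slem P <= c <-> forall v, `|quad (deviation P) v| <= c * quad 1%:M v.
Proof.
move=> n_gt0 Pf; have [_ _ Psym _] := Pf; have Msym := deviation_sym Psym.
have [t tE tM] := eigvals_feasible n_gt0 Pf.
have -> : slem P = \big[Num.max/0]_(x <- t) `|x|.
  rewrite /slem tE [RHS](big_nth 0) big_add1 /=; congr bigop.
  by congr (index_iota 0 _); rewrite -[n in n.-1](size_eigvals Psym) tE.
split=> [tc v|qM].
  apply: quad_root_char_poly => // x.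
  rewrite -mem_eigvals // -(perm_mem tM) inE => /predU1P[->|xt].
    by rewrite normr0 (le_trans _ tc) // bigmax_ge_id.
  by apply: le_trans tc; exact: le_bigmax_seq.
have xc x : x \in 0 :: t -> `|x| <= c.
  rewrite (perm_mem tM) mem_eigvals //; exact: root_char_poly_quad.
rewrite big_seq; apply: bigmax_le => [|x xt]; last by rewrite xc // inE xt orbT.
(* The initial value 0 of the maximum requires [0 <= c], which holds because 0 is an eigenvalue of
   [deviation P]. *)
by rewrite -(normr0 R) xc ?mem_head.
Qed.

Lemma slem_ge0 (R : realType) n (P : 'M[R]_n) : 0 <= slem P.
Proof. exact: bigmax_ge_id. Qed.

Lemma slem_le1 (R : realType) n (e : rel 'I_n) (P : 'M[R]_n) :
  (0 < n)%N -> feasible e P -> slem P <= 1.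
Proof.
move=> n_gt0 Pf; have [_ _ Psym _] := Pf.
have [t tE tM] := eigvals_feasible n_gt0 Pf.
rewrite /slem big_seq; apply: bigmax_le => // i.
rewrite mem_index_iota => /andP[_ iltn].
apply: (@root_char_poly_quad _ _ P) => [v|]; first exact: feasible_quad_le Pf.
by rewrite -mem_eigvals // mem_nth // size_eigvals.
Qed.

(** * Existence of a minimizer *)

Lemma closed_forall (T : topologicalType) (I : Type) (A : I -> set T) :
  (forall i, closed (A i)) -> closed [set x | forall i, A i x].
Proof.
move=> cA; have -> : [set x | forall i, A i x] = \bigcap_i A i.
  by apply/seteqP; split=> x Ax i; [move=> _|]; apply: Ax.
exact: closed_bigI.
Qed.

Lemma closed_impl (T : topologicalType) (b : bool) (A : set T) :
  closed A -> closed [set x | b -> A x].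
Proof.
case: b => cA.
  by have -> : [set x | true -> A x] = A by apply/seteqP; split=> x Ax //=; exact: Ax.
have -> : [set x | false -> A x] = setT by apply/seteqP; split.
exact: closedT.
Qed.

Lemma closed_preim (T U : topologicalType) (f : T -> U) (D : set U) :
  continuous f -> closed D -> closed [set z | D (f z)].
Proof. by move=> fc; apply: preimage_closed => z _; exact: fc. Qed.

Lemma continuous_sum (R : numFieldType) (T : topologicalType) (I : finType)
    (f : I -> T -> R) :
  (forall i, continuous (f i)) -> continuous (fun x => \sum_i f i x).
Proof. by move=> fc; apply: continuous_big => // z; exact: add_continuous. Qed.

Lemma continuous_vec_mx (R : numFieldType) n (i j : 'I_n) :
  continuous (fun z : 'rV[R]_(n * n) * R => vec_mx z.1 i j).
Proof.
move=> z; have -> : (fun z : 'rV[R]_(n * n) * R => vec_mx z.1 i j) =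
    (fun x : 'rV[R]_(n * n) => x 0 (mxvec_index i j)) \o fst.
  by apply/funext => x /=; rewrite mxE.
by apply: continuous_comp; [exact: cvg_fst|exact: coord_continuous].
Qed.

(* Pairs (P, c) with P feasible and slem P <= c; P is stored as a row vector
   because the library's compactness results are for row vectors. *)
Definition slem_epigraph (R : realType) n (e : rel 'I_n) :
    set ('rV[R]_(n * n) * R) :=
  [set z | feasible e (vec_mx z.1) /\
    forall v, `|quad (deviation (vec_mx z.1)) v| <= z.2 * quad 1%:M v].

(** Entry by entry, each constraint puts a continuous real function of the matrix in a closed
    set. *)
Lemma closed_feasible (R : realType) n (e : rel 'I_n) :
  closed [set z : 'rV[R]_(n * n) * R | feasible e (vec_mx z.1)].
Proof.
have cP := @continuous_vec_mx R n.
rewrite (_ : [set _ | _] =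
  [set z | forall i j, 0 <= vec_mx z.1 i j] `&`
  [set z | forall i, \sum_j vec_mx z.1 i j = 1] `&`
  [set z | forall i j, vec_mx z.1 i j - vec_mx z.1 j i = 0] `&`
  [set z | forall i j, i != j -> ~~ e i j -> vec_mx z.1 i j = 0]); last first.
  apply/seteqP; split=> z.
    move=> Pf; have [P0 _ Psym P1] := Pf; split=> //; split; first split=> //.
      by move=> i; exact: feasible_row_sum Pf.
    by move=> i j; rewrite {1}Psym [X in X - _]mxE subrr.
  move=> [[[/= P0 rowP] Psym] Pe]; split=> //.
    apply/colP => i; rewrite !mxE -[RHS](rowP i).
    by apply: eq_bigr => j _; rewrite [X in _ * X]mxE mulr1.
  apply/matrixP => i j; rewrite [RHS]mxE; apply/eqP.
  by rewrite -subr_eq0; apply/eqP.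
apply: closedI; first apply: closedI; first apply: closedI.
- apply: closed_forall => i; apply: closed_forall => j.
  exact: (closed_preim (cP i j) (@closed_ge _ 0)).
- apply: closed_forall => i.
  exact: (closed_preim (continuous_sum (cP i)) (@closed_eq _ 1)).
- apply: closed_forall => i; apply: closed_forall => j.
  apply: (@closed_preim _ _ (fun z => vec_mx z.1 i j - vec_mx z.1 j i)) (@closed_eq _ 0).
  by move=> z; apply: cvgB; exact: cP.
- apply: closed_forall => i; apply: closed_forall => j.
  apply: closed_impl; apply: closed_impl.
  exact: (closed_preim (cP i j) (@closed_eq _ 0)).
Qed.

(** For a fixed [v] the bound says that a continuous function of [(P, c)] is nonnegative; intersect
    over all [v]. *)
Lemma closed_slem_epigraph (R : realType) n (e : rel 'I_n) :
  closed (@slem_epigraph R n e).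
Proof.
apply: closedI; first exact: closed_feasible.
apply: closed_forall => v.
have -> : (fun z : 'rV[R]_(n * n) * R =>
      `|quad (deviation (vec_mx z.1)) v| <= z.2 * quad 1%:M v : Prop) =
    (fun z => 0 <= z.2 * quad 1%:M v -
      `|\sum_i \sum_j v 0 i * v 0 j * (vec_mx z.1 i j - n%:R^-1)|).
  apply/funext => z; rewrite subr_ge0 quadE.
  by under eq_bigr do under eq_bigr do rewrite deviationE.
apply: closed_preim (@closed_ge _ 0) => z; apply: cvgB.
  by apply: cvgM; [exact: cvg_snd|exact: cvg_cst].
apply: cvg_norm; move: z; apply: continuous_sum => i; apply: continuous_sum => j z.
apply: cvgM; first exact: cvg_cst.
by apply: cvgB; [exact: continuous_vec_mx|exact: cvg_cst].
Qed.

Lemma feasible1 (R : realType) n (e : rel 'I_n) : feasible e (1%:M : 'M[R]_n).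
Proof.
split; rewrite ?mul1mx ?trmx1 // => i j; rewrite mxE; first by rewrite ler0n.
by move=> /negPf ->.
Qed.

(** What is minimized is the coordinate [c], a continuous function, over a compact piece of the
    epigraph, rather than [slem] itself. *)
Lemma slem_min (R : realType) n (e : rel 'I_n) : (0 < n)%N ->
  exists2 P : 'M[R]_n, feasible e P &
    forall P', feasible e P' -> slem P <= slem P'.
Proof.
move=> n_gt0.
(* Entries of a feasible matrix and its [slem] all lie in [[0, 1]], so the truncation keeps every
   pair [(P, slem P)]. *)
pose box := [set x : 'rV[R]_(n * n) | forall i, `[0, 1]%classic (x ord0 i)].
pose K := box `*` `[0, 1]%classic `&` @slem_epigraph R n e.
have memK P : feasible e P -> K (mxvec P, slem P).
  move=> Pf; have [P0 _ _ _] := Pf; split; last first.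
    by rewrite /slem_epigraph /= mxvecK; split=> //; apply/(slem_leP _ n_gt0 Pf).
  split=> /=; last by rewrite in_itv /= slem_ge0 (slem_le1 n_gt0 Pf).
  move=> k; case/mxvec_indexP: k => i j; rewrite mxvecE /= in_itv /= P0 /=.
  rewrite -(feasible_row_sum i Pf) (bigD1 j) //= lerDl.
  by apply: sumr_ge0 => l _; exact: P0.
have K0 : K !=set0 by exists (mxvec 1%:M, slem (1%:M : 'M[R]_n)); apply/memK/feasible1.
have Kc : compact K.
  apply: compact_closedI; last exact: closed_slem_epigraph.
  apply: compact_setX; last exact: segment_compact.
  by apply: (@rV_compact R _ (fun=> `[0, 1]%classic)) => i; exact: segment_compact.
have [|z zK zmin] := @compact_EVT_min _ R snd K K0 Kc.
  by apply: continuous_subspaceT => z; exact: cvg_snd.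
move: zK; rewrite inE => -[_ [Pf zle]]; exists (vec_mx z.1) => // P' P'f.
(* Chain [slem (vec_mx z.1) <= z.2 <= slem P']: the first from the epigraph, the second from
   minimality of [z]. *)
apply: le_trans (zmin (mxvec P', slem P') _); first exact/(slem_leP _ n_gt0 Pf).
by rewrite inE; exact: memK.
Qed.

(** * Averaging over automorphisms *)

Lemma perm_actE (R : realType) n (s : {perm 'I_n}) (P : 'M[R]_n) i j :
  perm_act s P (s i) (s j) = P i j.
Proof.
rewrite /perm_act mxE (bigD1 j) //= big1 ?addr0 => [|l lj]; last first.
  by rewrite [trmx _ _ _]mxE [(permQ _ _) _ _]mxE (inj_eq perm_inj) eq_sym (negPf lj) mulr0.
rewrite [trmx _ _ _]mxE [(permQ _ _) _ _]mxE eqxx mulr1 mxE (bigD1 i) //= big1 ?addr0 => [|l li].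
  by rewrite mxE eqxx mul1r.
by rewrite mxE (inj_eq perm_inj) eq_sym (negPf li) mul0r.
Qed.

Lemma perm_actVE (R : realType) n (s : {perm 'I_n}) (P : 'M[R]_n) i j :
  perm_act s P i j = P ((s^-1)%g i) ((s^-1)%g j).
Proof. by rewrite -{1}[ i](permKV s) -{1}[j](permKV s) perm_actE. Qed.

(** The product [s * t] of permutations applies [s] first, hence the reversed order. *)
Lemma perm_actM (R : realType) n (s t : {perm 'I_n}) (P : 'M[R]_n) :
  perm_act t (perm_act s P) = perm_act (s * t)%g P.
Proof. by apply/matrixP => i j; rewrite !perm_actVE invMg !permM. Qed.

Lemma feasible_perm_act (R : realType) n (e : rel 'I_n) s (P : 'M[R]_n) :
  s \in graph_aut e -> feasible e P -> feasible e (perm_act s P).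
Proof.
rewrite inE => /forallP sA Pf; have [P0 _ Psym Pe] := Pf; split=> [i j||| i j ij eij].
- by rewrite perm_actVE.
- apply/colP => i; rewrite !mxE (reindex_inj (@perm_inj _ s)) /=.
  rewrite -[RHS](feasible_row_sum ((s^-1)%g i) Pf); apply: eq_bigr => j _.
  by rewrite [X in _ * X]mxE mulr1 perm_actVE permK.
- by apply/matrixP => i j; rewrite [RHS]mxE !perm_actVE {1}Psym mxE.
- rewrite perm_actVE Pe ?(inj_eq perm_inj) //.
  have /forallP/(_ ((s^-1)%g j))/eqP := sA ((s^-1)%g i).
  by rewrite !permKV => <-.
Qed.

(** The constant matrix subtracted in [deviation] is invariant under simultaneous permutation of
    rows and columns, so the permutation can be moved onto [v]. *)
Lemma quad_deviation_perm_act (R : realType) n s (P : 'M[R]_n) v :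
  quad (deviation (perm_act s P)) v = quad (deviation P) (\row_i v 0 (s i)).
Proof.
rewrite !quadE (reindex_inj (@perm_inj _ s)); apply: eq_bigr => i _ /=.
rewrite (reindex_inj (@perm_inj _ s)); apply: eq_bigr => j _ /=.
by rewrite !deviationE perm_actE !mxE.
Qed.

Lemma slem_perm_act (R : realType) n (e : rel 'I_n) s (P : 'M[R]_n) :
  (0 < n)%N -> s \in graph_aut e -> feasible e P ->
  slem (perm_act s P) <= slem P.
Proof.
move=> n_gt0 sA Pf; apply/(slem_leP _ n_gt0 (feasible_perm_act sA Pf)) => v.
have /(slem_leP _ n_gt0 Pf) := lexx (slem P).
rewrite quad_deviation_perm_act => /(_ (\row_i v 0 (s i))).
congr (_ <= _ * _); rewrite !quad1E [RHS](reindex_inj (@perm_inj _ s)).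
by apply: eq_bigr => i _; rewrite mxE.
Qed.

Definition mx_average (R : realType) n (I : finType) (A : {set I})
    (F : I -> 'M[R]_n) : 'M[R]_n := #|A|%:R^-1 *: \sum_(s in A) F s.

Lemma mx_averageE (R : realType) n (I : finType) (A : {set I})
    (F : I -> 'M[R]_n) i j :
  mx_average A F i j = #|A|%:R^-1 * \sum_(s in A) F s i j.
Proof. by rewrite mxE summxE. Qed.

Lemma average_cst (R : numFieldType) (I : finType) (A : {set I}) (x : R) :
  (0 < #|A|)%N -> #|A|%:R^-1 * \sum_(s in A) x = x.
Proof.
by move=> A_gt0; rewrite sumr_const -[x *+ _]mulr_natl mulKf // pnatr_eq0 -lt0n.
Qed.

Lemma feasible_average (R : realType) n (I : finType) (A : {set I})
    (F : I -> 'M[R]_n) (e : rel 'I_n) :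
  (0 < #|A|)%N -> (forall s, s \in A -> feasible e (F s)) ->
  feasible e (mx_average A F).
Proof.
move=> A_gt0 Ff; split=> [i j||| i j ij eij].
- rewrite mx_averageE mulr_ge0 ?invr_ge0 ?ler0n //.
  by apply: sumr_ge0 => s /Ff[].
- rewrite -scalemxAl mulmx_suml.
  rewrite (eq_bigr (fun=> const_mx 1)) => [|s /Ff[] //].
  apply/colP => i; rewrite !mxE summxE -[RHS](average_cst _ A_gt0); congr (_ * _).
  by apply: eq_bigr => s _; rewrite mxE.
- apply/matrixP => i j; rewrite [RHS]mxE !mx_averageE; congr (_ * _).
  by apply: eq_bigr => s /Ff[_ _ Fsym _]; rewrite {1}Fsym mxE.
- by rewrite mx_averageE big1 ?mulr0 // => s /Ff[_ _ _]; apply.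
Qed.

(** [deviation] is affine, so it commutes with averages, and [quad] is linear in the matrix. *)
Lemma quad_deviation_average (R : realType) n (I : finType) (A : {set I})
    (F : I -> 'M[R]_n) v :
  (0 < #|A|)%N ->
  quad (deviation (mx_average A F)) v =
  #|A|%:R^-1 * \sum_(s in A) quad (deviation (F s)) v.
Proof.
move=> A_gt0.
have -> : deviation (mx_average A F) =
    #|A|%:R^-1 *: \sum_(s in A) deviation (F s).
  apply/matrixP => i j; rewrite deviationE mx_averageE [RHS]mxE summxE.
  rewrite -[X in _ - X](average_cst _ A_gt0) -mulrBr -sumrB; congr (_ * _).
  by apply: eq_bigr => s _; rewrite deviationE.
rewrite /quad -scalemxAr -scalemxAl mxE; congr (_ * _).
by rewrite mulmx_sumr mulmx_suml summxE.
Qed.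

(** Convexity: by the triangle inequality, the bounds [c * quad 1%:M v] for the members average to
    the same bound. *)
Lemma slem_average (R : realType) n (I : finType) (A : {set I})
    (F : I -> 'M[R]_n) (e : rel 'I_n) (c : R) :
  (0 < #|A|)%N -> (0 < n)%N ->
  (forall s, s \in A -> feasible e (F s)) ->
  (forall s, s \in A -> slem (F s) <= c) -> slem (mx_average A F) <= c.
Proof.
move=> A_gt0 n_gt0 Ff Fc.
apply/(slem_leP _ n_gt0 (feasible_average A_gt0 Ff)) => v.
rewrite quad_deviation_average // -[leRHS](average_cst _ A_gt0) normrM.
rewrite ger0_norm ?invr_ge0 ?ler0n // ler_wpM2l ?invr_ge0 ?ler0n //.
rewrite (le_trans (ler_norm_sum _ _ _)) // ler_sum // => s sA.
by move: v; apply/(slem_leP _ n_gt0 (Ff s sA)); exact: Fc.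
Qed.

Lemma graph_aut1 n (e : rel 'I_n) : 1%g \in graph_aut e.
Proof. by rewrite inE; apply/forallP => i; apply/forallP => j; rewrite !perm1. Qed.

Lemma graph_autM n (e : rel 'I_n) s t :
  s \in graph_aut e -> (t * s \in graph_aut e)%g = (t \in graph_aut e).
Proof.
rewrite !inE => /forallP sA; apply: eq_forallb => i; apply: eq_forallb => j.
by rewrite !permM; have /forallP/(_ (t j))/eqP -> := sA (t i).
Qed.

(** Acting by [s] turns the term of [t] into that of [t * s], and right multiplication by [s]
    permutes the automorphism group. *)
Lemma perm_act_average (R : realType) n (e : rel 'I_n) s (P : 'M[R]_n) :
  s \in graph_aut e ->
  perm_act s (mx_average (graph_aut e) (fun t => perm_act t P)) =
  mx_average (graph_aut e) (fun t => perm_act t P).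
Proof.
move=> sA; apply/matrixP => i j; rewrite perm_actVE !mx_averageE; congr (_ * _).
rewrite [RHS](reindex_inj (mulIg s)) /=.
apply: eq_big => t; first by rewrite graph_autM.
by move=> _; rewrite -perm_actM [RHS]perm_actVE.
Qed.

Theorem theorem2p1 (R : realType) (n : nat) (n_gt0 : (0 < n)%N)
    (e : rel 'I_n) (e_sym : symmetric e) (e_irr : irreflexive e)
    (e_conn : connected_graph e) :
  exists P : 'M[R]_n,
    fixed_feasible e P /\
    slem P = inf [set slem P' | P' in @feasible R n e].
Proof.
have [P0 P0f P0min] := @slem_min R n e n_gt0.
set A := graph_aut e.
have A_gt0 : (0 < #|A|)%N by apply/card_gt0P; exists 1%g; exact: graph_aut1.
have Ff s : s \in A -> feasible e (perm_act s P0).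
  by move=> sA; exact: feasible_perm_act.
exists (mx_average A (fun t => perm_act t P0)); have Pf := feasible_average A_gt0 Ff.
split; first by split=> // s sA; exact: perm_act_average.
have Pmin P' : feasible e P' -> slem (mx_average A (fun t => perm_act t P0)) <= slem P'.
  move=> P'f; apply: le_trans (P0min _ P'f).
  by apply: (slem_average A_gt0 n_gt0 Ff) => s sA; exact: slem_perm_act P0f.
(* The set of values is nonempty and bounded below by 0, so [inf] is a genuine greatest lower
   bound. *)
apply/eqP; rewrite eq_le; apply/andP; split.
  apply: lb_le_inf; first by exists (slem P0), P0.
  by move=> _ [P' P'f <-]; exact: Pmin.
apply: ge_inf; last by exists (mx_average A (fun t => perm_act t P0)).
by exists 0 => _ [P' _ <-]; exact: slem_ge0.
Qed.
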